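(* Consider the interconnected system, the local optimal control problems $\mathrm{OCP}_i(t)$ and the closed loop described in the context. Suppose the problems $\mathrm{OCP}_i(0)$, $i=1,\dots,\ell$, are feasible and that at every transition $t\to t+1$, $t\in\mathbb Z_{\ge0}$, for every $i$: (A) $x_i^{\mathrm{nom},\star}(l+1|t)\in\mathcal X_i\ominus\mathbb B_{\delta_i(l|t+1)}$ for all $l=1,\dots,M-1$; (B) there exists $v_i\in\mathcal U_i$ with $$W_i\bigl(g_i(\tilde x_i^{\mathrm{nom}}(M-1|t+1),\bar x_{\mathcal N_i}(M-1|t+1),v_i)\bigr)\le\max_{j\in\mathcal G_i^\gamma}\gamma_{ij}\bigl(W_j(x_j(t+1))\bigr).$$ If $x(0)\in\mathcal X$, then $x(t)\in\mathcal X$ and $u(t)\in\mathcal U$ for all $t\in\mathbb Z_{\ge0}$.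
   Context: Notation. $\|\cdot\|$ is the Euclidean norm, $\mathbb B_\Delta=\{e:\|e\|\le\Delta\}$, $\mathcal S\ominus\mathcal E=\{z: z+e\in\mathcal S\ \forall e\in\mathcal E\}$. For $v_{\mathcal N_i}=(v_j)_{j\in\mathcal N_i}$, $\|v_{\mathcal N_i}\|_{\mathcal N_i,\infty}=\max_{j\in\mathcal N_i}\|v_j\|$. Maxima over empty index sets are $0$. $\mathcal K$: continuous strictly increasing $\alpha:\mathbb R_{\ge0}\to\mathbb R_{\ge0}$ with $\alpha(0)=0$; $\mathcal K_\infty$: unbounded functions in $\mathcal K$; $\alpha<\mathrm{id}$ means $\alpha(s)<s$ for all $s>0$. System. $x_i(t+1)=g_i(x_i(t),x_{\mathcal N_i}(t),u_i(t))$, $i=1,\dots,\ell$, with constraint sets $\mathcal X_i\subseteq\mathbb R^{n_i}$, $\mathcal U_i\subseteq\mathbb R^{m_i}$, neighbor sets $\mathcal N_i\subset\{1,\dots,\ell\}\setminus\{i\}$, $x_{\mathcal N_i}=(x_j)_{j\in\mathcal N_i}$, $\mathcal X_{\mathcal N_i}=\prod_{j\in\mathcal N_i}\mathcal X_j$, $\mathcal X=\prod_i\mathcal X_i$, $\mathcal U=\prod_i\mathcal U_i$, $n=\sum_i n_i$, $x=(x_i)_i$, $u=(u_i)_i$, $g=(g_1,\dots,g_\ell)$, regarded as a map $g:\mathcal X\times\mathcal U\to\mathbb R^n$, $g(0,0)=0$; $g$ is $\mathcal K$-bounded: there are $\kappa_1,\kappa_2\in\mathcal K$ with $\|g(\xi,\mu)\|\le\kappa_1(\|\xi\|)+\kappa_2(\|\mu\|)$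 on $\mathcal X\times\mathcal U$ (and likewise each $g_i$ on $\mathcal X_i\times\mathcal X_{\mathcal N_i}\times\mathcal U_i$). There are constants $L_{i,1},L_{i,2}>0$, $L_{i,3}\ge0$ with $$\|g_i(\xi_i,\xi_{\mathcal N_i},\mu_i)-g_i(\xi_i',\xi_{\mathcal N_i}',\mu_i')\|\le L_{i,1}\|\xi_i-\xi_i'\|+L_{i,2}\|\xi_{\mathcal N_i}-\xi'_{\mathcal N_i}\|_{\mathcal N_i,\infty}+L_{i,3}\|\mu_i-\mu_i'\|$$ on the constraint domain $\mathcal X_i\times\mathcal X_{\mathcal N_i}\times\mathcal U_i$. Design data. $M\ge2$ integer, $\lambda>0$, functions $W_i:\mathbb R^{n_i}\to\mathbb R_{\ge0}$ with $\underline\alpha_i(\|\xi_i\|)\le W_i(\xi_i)\le\overline\alpha_i(\|\xi_i\|)$ for some $\underline\alpha_i,\overline\alpha_i\in\mathcal K_\infty$, and gains $\gamma_{ij}\in\mathcal K_\infty\cup\{0\}$ with $\gamma_{i_1i_2}\circ\gamma_{i_2i_3}\circ\cdots\circ\gamma_{i_ri_1}<\mathrm{id}$ for every cycle of distinct indices, $r=1,\dots,\ell$. $\mathcal G_i^\gamma=\{j:\gamma_{ij}\not\equiv0\}$. Packets. At time $t$ subsystem $i$ sends $(\bar x_i(l|t),\bar r_i(l|t))_{l=0}^{M-1}$ to the controllers of which it is a neighbor, where $\bar x_i(0|t)=x_i(t)$, $\bar r_i(0|t)=0$, and for $t\ge1$, $l=1,\dots,M-1$: $\bar x_i(l|t)=x_i^{\mathrm{nom},\star}(l+1|t-1)$,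 $\bar r_i(l|t)=r_i^\star(l+1|t-1)$. At $t=0$ packets (with nonnegative radii) are supplied by a feasible initialization procedure. At time $t$ controller $i$ knows the packets of all $j\in\mathcal N_i$ and the scalars $W_j(x_j(t))$, $j\in\mathcal G_i^\gamma$. Budget. $\mathcal B_i(l|t)=L_{i,2}\max_{j\in\mathcal N_i}\bar r_j(l|t)+d_i(l|t)$, $l=0,\dots,M-1$, where $d_i(l|t)=L_{i,2}\max_{j\in\mathcal N_i}\|\bar x_j(l|t)-\bar x_j(l+1|t-1)\|$ for $l\le M-2$ (for $t=0$, given nonnegative initialization values) and $d_i(M-1|t)=d_i^{\mathrm{ter}}(t)\ge0$ is prescribed. $\mathrm{OCP}_i(t)$: minimize over $(u_i(0|t),\dots,u_i(M-1|t))$ and $(r_i(1|t),\dots,r_i(M-1|t))$ the cost $\sum_{l=0}^{M-1}W_i(x_i^{\mathrm{nom}}(l|t))+\lambda\sum_{l=1}^{M-1}r_i(l|t)$ subject to: $x_i^{\mathrm{nom}}(0|t)=x_i(t)$; $x_i^{\mathrm{nom}}(l+1|t)=g_i(x_i^{\mathrm{nom}}(l|t),\bar x_{\mathcal N_i}(l|t),u_i(l|t))$ and $u_i(l|t)\in\mathcal U_i$ for $l=0,\dots,M-1$; $r_i(l|t)\ge0$ and $x_i^{\mathrm{nom}}(l|t)\in\mathcal X_i\ominus\mathbb B_{r_i(l|t)}$ for $l=1,\dots,M-1$; $r_i(l+1|t)\ge L_{i,1}r_i(l|t)+\mathcal B_i(l|t)$ for $l=0,\dots,M-2$, with $r_i(0|t):=0$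 fixed; and $W_i(x_i^{\mathrm{nom}}(M|t))\le\max_{j\in\mathcal G_i^\gamma}\gamma_{ij}(W_j(x_j(t)))$. Optimizers carry a star; existence of a minimizer is understood whenever an optimizer is invoked. $r_i^\star(0|t)=0$ and $r_i^\star(M|t):=L_{i,1}r_i^\star(M-1|t)+\mathcal B_i(M-1|t)$. The closed loop applies $u_i(t)=u_i^\star(0|t)$ for every $i$. Shifted candidate at $t+1$. $\tilde u_i(l|t+1)=u_i^\star(l+1|t)$, $l=0,\dots,M-2$; $\tilde x_i^{\mathrm{nom}}(0|t+1)=x_i(t+1)$, $\tilde x_i^{\mathrm{nom}}(l+1|t+1)=g_i(\tilde x_i^{\mathrm{nom}}(l|t+1),\bar x_{\mathcal N_i}(l|t+1),\tilde u_i(l|t+1))$; $\tilde r_i(0|t+1)=0$, $\tilde r_i(l+1|t+1)=L_{i,1}\tilde r_i(l|t+1)+\mathcal B_i(l|t+1)$; $\chi_i(0|t+1)=0$, $\chi_i(l+1|t+1)=L_{i,1}\chi_i(l|t+1)+L_{i,2}\|\bar x_{\mathcal N_i}(l|t+1)-\bar x_{\mathcal N_i}(l+1|t)\|_{\mathcal N_i,\infty}$ (all for $l=0,\dots,M-2$); $\delta_i(l|t+1)=\chi_i(l|t+1)+\tilde r_i(l|t+1)$, $l=1,\dots,M-1$. *)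

(* Defs.v *)
From HB Require Import structures.
From mathcomp Require Import all_boot all_order all_algebra.
From mathcomp Require Import all_classical all_reals all_analysis.
Set Implicit Arguments.
Unset Strict Implicit.
Unset Printing Implicit Defensive.
Import Order.TTheory GRing.Theory Num.Theory.
Import numFieldNormedType.Exports.
Local Open Scope classical_set_scope.
Local Open Scope ring_scope.

(* The norm that the library puts on matrices is the maximum norm. *)
Definition norm2 (R : realType) (k : nat) (v : 'rV[R]_k) : R :=
  Num.sqrt (\sum_(j < k) v 0 j ^+ 2).

Definition ball2 (R : realType) (k : nat) (r : R) : set 'rV[R]_k :=
  [set e | norm2 e <= r].

(* Pontryagin difference *)
Definition pdiff (R : realType) (k : nat) (A E : set 'rV[R]_k) : set 'rV[R]_k :=
  [set z | forall e, E e -> A (z + e)].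

(* Comparison functions R>=0 -> R>=0 are encoded as functions R -> R of which
   only the values on [0, +oo[ are ever constrained or used. *)
Definition classK (R : realType) (a : R -> R) : Prop :=
  [/\ {within [set s : R | 0 <= s], continuous a},
      (forall s t, 0 <= s -> s < t -> a s < a t) & a 0 = 0].

Definition classKinf (R : realType) (a : R -> R) : Prop :=
  classK a /\ forall b, exists2 s, 0 <= s & b < a s.

Definition zero_gain (R : realType) (a : R -> R) : Prop :=
  forall s, 0 <= s -> a s = 0.

(* gain_chain gam i [:: j_1; ...; j_r] k is the composition
   gam i j_1 \o gam j_1 j_2 \o ... \o gam j_r k. *)
Fixpoint gain_chain (R : realType) (I : Type) (gam : I -> I -> R -> R)
    (i : I) (s : seq I) (k : I) : R -> R :=
  if s is j :: s' then gam i j \o gain_chain gam j s' k else gam i k.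

Definition cyclic_small_gain (R : realType) (I : eqType)
    (gam : I -> I -> R -> R) : Prop :=
  forall (i : I) (s : seq I), uniq (i :: s) ->
    forall a : R, 0 < a -> gain_chain gam i s i a < a.

(* [net_g] is total; its values matter only on the constraint domain, and every
   hypothesis on it other than g(0,0) = 0 is imposed on that domain only. *)
Record network (R : realType) := Network {
  net_ell : nat;
  net_n : 'I_net_ell -> nat;
  net_m : 'I_net_ell -> nat;
  net_N : 'I_net_ell -> {set 'I_net_ell};
  net_X : forall i, set 'rV[R]_(net_n i);
  net_U : forall i, set 'rV[R]_(net_m i);
  net_g : forall i, 'rV[R]_(net_n i) ->
    (forall j : {j : 'I_net_ell | j \in net_N i}, 'rV[R]_(net_n (val j))) ->
    'rV[R]_(net_m i) -> 'rV[R]_(net_n i);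
  net_L1 : 'I_net_ell -> R;
  net_L2 : 'I_net_ell -> R;
  net_L3 : 'I_net_ell -> R }.

Arguments net_X {R S} i _ : rename.
Arguments net_U {R S} i _ : rename.
Arguments net_g {R S i} _ _ _ : rename.

Section Network.
Variables (R : realType) (S : network R).

Definition agent : Type := 'I_(net_ell S).
Definition nbr (i : agent) : Type := {j : agent | j \in net_N i}.
Definition lstate (i : agent) : Type := 'rV[R]_(net_n i).
Definition linput (i : agent) : Type := 'rV[R]_(net_m i).
Definition state : Type := forall i : agent, lstate i.
Definition input : Type := forall i : agent, linput i.
Definition nstate (i : agent) : Type := forall j : nbr i, lstate (val j).

Definition nbrs (i : agent) (x : state) : nstate i := fun j => x (val j).
Arguments nbrs i x _ : clear implicits.

Definition nbr_norm (i : agent) (v : nstate i) : R :=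
  \big[Num.max/0]_(j : {j : 'I_(net_ell S) | j \in net_N i}) norm2 (v j).

Definition nbr_dist (i : agent) (v w : nstate i) : R :=
  @nbr_norm i (fun j => v j - w j).

Definition in_X (x : state) : Prop := forall i, net_X i (x i).
Definition in_U (u : input) : Prop := forall i, net_U i (u i).
Definition in_XN (i : agent) (v : nstate i) : Prop :=
  forall j, net_X (val j) (v j).

Definition g_all (x : state) (u : input) : state :=
  fun i => net_g (x i) (nbrs i x) (u i).

(* Euclidean norms of the stacked vectors of R^n and R^m *)
Definition state_norm (x : state) : R :=
  Num.sqrt (\sum_(i < net_ell S) norm2 (x i) ^+ 2).
Definition input_norm (u : input) : R :=
  Num.sqrt (\sum_(i < net_ell S) norm2 (u i) ^+ 2).

Definition K_bounded : Prop :=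
  exists k1 k2 : R -> R, [/\ classK k1, classK k2 &
    forall (x : state) (u : input), in_X x -> in_U u ->
      state_norm (g_all x u) <= k1 (state_norm x) + k2 (input_norm u)].

Definition local_K_bounded (i : agent) : Prop :=
  exists k1 k2 k3 : R -> R, [/\ classK k1, classK k2, classK k3 &
    forall (xi : lstate i) (xN : nstate i) (ui : linput i),
      net_X i xi -> in_XN xN -> net_U i ui ->
      norm2 (net_g xi xN ui)
        <= k1 (norm2 xi) + k2 (nbr_norm xN) + k3 (norm2 ui)].

Record network_spec : Prop := NetworkSpec {
  nbr_irrefl : forall i : agent, i \notin net_N i;
  g_zero : forall i : agent, @net_g R S i 0 (fun=> 0) 0 = 0;
  g_K_bounded : K_bounded;
  g_local_K_bounded : forall i : agent, local_K_bounded i;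
  L1_gt0 : forall i : agent, 0 < net_L1 i;
  L2_gt0 : forall i : agent, 0 < net_L2 i;
  L3_ge0 : forall i : agent, 0 <= net_L3 i;
  g_lipschitz : forall (i : agent) (xi xi' : lstate i) (xN xN' : nstate i)
      (ui ui' : linput i),
    net_X i xi -> in_XN xN -> net_U i ui ->
    net_X i xi' -> in_XN xN' -> net_U i ui' ->
    norm2 (net_g xi xN ui - net_g xi' xN' ui')
      <= net_L1 i * norm2 (xi - xi') + net_L2 i * nbr_dist xN xN'
         + net_L3 i * norm2 (ui - ui') }.

Record design := Design {
  hor : nat;                              (* the horizon M *)
  lam : R;
  lyap : forall i : agent, lstate i -> R;         (* W_i *)
  gain : agent -> agent -> R -> R;                (* gamma_ij *)
  d_init : agent -> nat -> R;             (* d_i(l|0) for l <= M - 2 *)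
  d_ter : agent -> nat -> R }.            (* d_i(M-1|t) *)

Record design_spec (D : design) : Prop := DesignSpec {
  hor_ge2 : (2 <= hor D)%N;
  lam_gt0 : 0 < lam D;
  lyap_ge0 : forall i (xi : lstate i), 0 <= lyap D xi;
  lyap_bounds : forall i : agent, exists lo up : R -> R,
    [/\ classKinf lo, classKinf up & forall xi : lstate i,
        lo (norm2 xi) <= lyap D xi <= up (norm2 xi)];
  gain_class : forall i j : agent,
    classKinf (gain D i j) \/ zero_gain (gain D i j);
  gain_small : @cyclic_small_gain R 'I_(net_ell S) (gain D);
  d_init_ge0 : forall (i : agent) l, (l.+1 < hor D)%N -> 0 <= d_init D i l;
  d_ter_ge0 : forall (i : agent) t, 0 <= d_ter D i t }.

(* Signals of one run. The first argument of the last four is the time t at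
   which the data is computed, the second one is the prediction index l. *)
Record run := Run {
  traj : nat -> state;
  xbar : nat -> nat -> state;
  rbar : nat -> nat -> agent -> R;
  ustar : nat -> nat -> input;
  rstar : nat -> nat -> agent -> R }.

Fixpoint rollout (i : agent) (x0 : lstate i) (xN : nat -> nstate i)
    (u : nat -> linput i) (l : nat) : lstate i :=
  if l is l'.+1 then net_g (rollout x0 xN u l') (xN l') (u l') else x0.

Section Controller.
Variables (D : design) (c : run).

Definition d_budget (i : agent) (t l : nat) : R :=
  if (l.+1 < hor D)%N then
    if t is t'.+1 then
      net_L2 i * nbr_dist (nbrs i (xbar c t l)) (nbrs i (xbar c t' l.+1))
    else d_init D i l
  else d_ter D i t.

Definition budget (i : agent) (t l : nat) : R :=
  net_L2 i * (\big[Num.max/0]_(j in net_N i) rbar c t l j) + d_budget i t l.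

Definition in_support (i j : agent) : bool :=
  `[< ~ zero_gain (gain D i j) >].

(* max_{j in G_i^gamma} gamma_ij (W_j (x_j(t))) *)
Definition lyap_bound (i : agent) (t : nat) : R :=
  \big[Num.max/0]_(j < net_ell S | in_support i j)
     gain D i j (lyap D (traj c t j)).

Definition xnom (i : agent) (t : nat) (u : nat -> linput i) : nat -> lstate i :=
  rollout (traj c t i) (fun l => nbrs i (xbar c t l)) u.

(* Constraints of OCP_i(t) on (u(0), ..., u(M-1)) and (r(1), ..., r(M-1));
   the values of u and r at other indices are irrelevant, and r(0) is 0. *)
Record ocp_feasible_pt (i : agent) (t : nat) (u : nat -> linput i)
    (r : nat -> R) : Prop := OcpFeasiblePt {
  ocp_u : forall l, (l < hor D)%N -> net_U i (u l);
  ocp_r0 : r 0%N = 0;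
  ocp_r : forall l, (0 < l < hor D)%N -> 0 <= r l;
  ocp_x : forall l, (0 < l < hor D)%N ->
    pdiff (net_X i) (@ball2 R (net_n i) (r l)) (xnom t u l);
  ocp_tube : forall l, (l.+1 < hor D)%N ->
    net_L1 i * r l + budget i t l <= r l.+1;
  ocp_ter : lyap D (xnom t u (hor D)) <= lyap_bound i t }.

Definition ocp_cost (i : agent) (t : nat) (u : nat -> linput i)
    (r : nat -> R) : R :=
  \sum_(0 <= l < hor D) lyap D (xnom t u l)
  + lam D * \sum_(1 <= l < hor D) r l.

Definition ocp_feasible (i : agent) (t : nat) : Prop :=
  exists (u : nat -> linput i) (r : nat -> R), ocp_feasible_pt t u r.

Definition ocp_minimizer (i : agent) (t : nat) (u : nat -> linput i)
    (r : nat -> R) : Prop :=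
  ocp_feasible_pt t u r /\
  forall (u' : nat -> linput i) (r' : nat -> R),
    ocp_feasible_pt t u' r' -> ocp_cost t u r <= ocp_cost t u' r'.

Definition xnomstar (i : agent) (t : nat) : nat -> lstate i :=
  xnom t (fun l => ustar c t l i).

Definition uapp (t : nat) : input := ustar c t 0%N.

(* The equations defining the run are unconditional, but the starred data are
   minimizers only at those (i, t) at which OCP_i(t) is feasible: neither
   feasibility for t > 0 nor anything about u(t) is built in. Packets at t = 0
   are arbitrary, up to nonnegativity of the radii and to g_i being evaluated
   on its domain X_i x X_{N_i} x U_i in OCP_i(0). *)
Record closed_loop : Prop := ClosedLoop {
  cl_dyn : forall t, traj c t.+1 = g_all (traj c t) (uapp t);
  cl_opt : forall (i : agent) t, ocp_feasible i t ->
    @ocp_minimizer i t (fun l => ustar c t l i) (fun l => rstar c t l i);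
  cl_rstar0 : forall t i, rstar c t 0%N i = 0;
  cl_rstarM : forall t i, rstar c t (hor D) i =
    net_L1 i * rstar c t (hor D).-1 i + budget i t (hor D).-1;
  cl_xbar0 : forall t i, xbar c t 0%N i = traj c t i;
  cl_rbar0 : forall t i, rbar c t 0%N i = 0;
  cl_xbar : forall t l i, (0 < l < hor D)%N ->
    xbar c t.+1 l i = xnomstar i t l.+1;
  cl_rbar : forall t l i, (0 < l < hor D)%N ->
    rbar c t.+1 l i = rstar c t l.+1 i;
  cl_init_x : forall l i, (0 < l < hor D)%N -> in_XN (nbrs i (xbar c 0%N l));
  cl_init_r : forall l i, (0 < l < hor D)%N -> 0 <= rbar c 0%N l i }.

(* In the following the transition is t -> t + 1 and l is the prediction index
   at time t + 1. *)
Definition xtilde (i : agent) (t : nat) : nat -> lstate i :=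
  xnom t.+1 (fun l => ustar c t l.+1 i).

Fixpoint rtilde (i : agent) (t l : nat) : R :=
  if l is l'.+1 then net_L1 i * rtilde i t l' + budget i t.+1 l' else 0.

Fixpoint chi (i : agent) (t l : nat) : R :=
  if l is l'.+1 then
    net_L1 i * chi i t l'
    + net_L2 i * nbr_dist (nbrs i (xbar c t.+1 l')) (nbrs i (xbar c t l'.+1))
  else 0.

Definition delta (i : agent) (t l : nat) : R := chi i t l + rtilde i t l.

Definition tightening_cond (i : agent) (t : nat) : Prop :=
  forall l, (0 < l < hor D)%N ->
    pdiff (net_X i) (@ball2 R (net_n i) (delta i t l))
          (@xnomstar i t l.+1).

Definition terminal_cond (i : agent) (t : nat) : Prop :=
  exists2 v : linput i, net_U i v &
    lyap D (net_g (@xtilde i t (hor D).-1)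
                  (nbrs i (xbar c t.+1 (hor D).-1)) v)
      <= lyap_bound i t.+1.

End Controller.
End Network.

Arguments nbrs {R S} i x _.

(* Main.v *)
Require Import Defs.
From mathcomp Require Import all_boot all_order all_algebra.
From mathcomp Require Import all_classical all_reals all_analysis.
From mathcomp Require Import ring.
Set Implicit Arguments.
Unset Strict Implicit.
Unset Printing Implicit Defensive.
Import Order.TTheory GRing.Theory Num.Theory.
Local Open Scope ring_scope.

(* Recursive feasibility by shifting the optimal solution. Since every packet
   starts at the true state, x_i(t+1) is the first nominal prediction made at
   time t, hence admissible. The Lipschitz bound shows that the shifted nominal
   trajectory stays within chi_i(l|t+1) of the predictions
   x_i^{nom,*}(l+1|t), so the tightening condition (A) leaves room for the
   radii r~_i(l|t+1); condition (B) provides the last input. The packets sent at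
   t+1 must remain in the domain where g_i is Lipschitz: their last entry
   x_j^{nom,*}(M|t) is unconstrained by OCP_j(t), but (A) at l = M-1 puts it
   in X_j. *)

Section EuclideanNorm.
Variables (R : realType) (k : nat).
Implicit Types v w : 'rV[R]_k.

Lemma norm2_ge0 v : 0 <= norm2 v.
Proof. exact: sqrtr_ge0. Qed.

Lemma norm2_0 : norm2 (0 : 'rV[R]_k) = 0.
Proof. by rewrite /norm2 big1 ?sqrtr0 // => j _; rewrite mxE expr0n. Qed.

Lemma sqr_norm2 v : norm2 v ^+ 2 = \sum_(j < k) v 0 j ^+ 2.
Proof. by rewrite sqr_sqrtr // sumr_ge0 // => j _; exact: sqr_ge0. Qed.

Lemma norm2_eq0 v : norm2 v = 0 -> v = 0.
Proof.
move=> v0; have /eqP : \sum_(j < k) v 0 j ^+ 2 = 0.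
  by rewrite -sqr_norm2 v0 expr0n.
rewrite psumr_eq0 => [/allP v0j|j _]; last exact: sqr_ge0.
apply/rowP => j; rewrite mxE; apply/eqP; rewrite -sqrf_eq0.
exact: v0j (mem_index_enum j).
Qed.

Lemma norm2D v w : norm2 (v + w) <= norm2 v + norm2 w.
Proof.
(* The general case divides by both norms, so zero vectors are split off first. *)
have [/norm2_eq0->|v_neq0] := eqVneq (norm2 v) 0.
  by rewrite norm2_0 !add0r.
have [/norm2_eq0->|w_neq0] := eqVneq (norm2 w) 0.
  by rewrite norm2_0 !addr0.
set a := norm2 v; set b := norm2 w.
rewrite -ler_sqr ?nnegrE ?addr_ge0 ?norm2_ge0 // sqr_norm2.
(* Convexity of the square: (p + q)^2 <= (a + b) (p^2 / a + q^2 / b). *)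
have -> : (a + b) ^+ 2 =
    \sum_(j < k) (a + b) * (v 0 j ^+ 2 / a + w 0 j ^+ 2 / b).
  rewrite -mulr_sumr big_split /= -!mulr_suml -!sqr_norm2 -/a -/b expr2.
  by congr (_ * _); field; rewrite v_neq0 w_neq0.
apply: ler_sum => j _; rewrite mxE -subr_ge0.
have -> : (a + b) * (v 0 j ^+ 2 / a + w 0 j ^+ 2 / b) - (v 0 j + w 0 j) ^+ 2 =
    (v 0 j * b - w 0 j * a) ^+ 2 / (a * b).
  by field; rewrite v_neq0 w_neq0.
by rewrite divr_ge0 ?sqr_ge0 // mulr_ge0 ?norm2_ge0.
Qed.

(** Part [p] of the margin around [w] pays for moving the centre to [v]; part [q] remains. *)
Lemma pdiff_ball2_near (A : set 'rV[R]_k) (p q : R) v w :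
  pdiff A (ball2 (p + q)) w -> norm2 (v - w) <= p -> pdiff A (ball2 q) v.
Proof.
move=> Aw vw e eq; have -> : v + e = w + (v - w + e).
  by rewrite addrA [w + _]addrC subrK.
by apply: Aw; rewrite /ball2/=; apply: le_trans (norm2D _ _) (lerD vw eq).
Qed.

Lemma pdiff_ball2_sub (A : set 'rV[R]_k) (r : R) v :
  0 <= r -> pdiff A (ball2 r) v -> A v.
Proof. by move=> r0 Av; rewrite -[v]addr0; apply: Av; rewrite /ball2/= norm2_0. Qed.

End EuclideanNorm.

Lemma eq_rollout (R : realType) (S : network R) (i : agent S) (x0 : lstate i)
    (xN : nat -> nstate i) (u u' : nat -> linput i) l :
  (forall k, (k < l)%N -> u k = u' k) ->
  rollout x0 xN u l = rollout x0 xN u' l.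
Proof.
elim: l => //= l IHl uu'; rewrite uu' // IHl // => k kl.
by apply: uu'; exact: ltnW.
Qed.

Section RecursiveFeasibility.
Variables (R : realType) (S : network R) (D : design S) (c : run S).
Hypotheses (HS : network_spec S) (HD : design_spec D) (Hcl : closed_loop D c).

Let M_gt1 : (1 < hor D)%N := hor_ge2 HD.
Let M_gt0 : (0 < hor D)%N := ltnW M_gt1.
Let L1_ge0 (i : agent S) : 0 <= net_L1 i := ltW (L1_gt0 HS i).
Let L2_ge0 (i : agent S) : 0 <= net_L2 i := ltW (L2_gt0 HS i).

Lemma nbr_dist_ge0 (i : agent S) (v w : nstate i) : 0 <= nbr_dist v w.
Proof.
rewrite /nbr_dist /nbr_norm; elim/big_rec: _ => // j x _ x0.
by rewrite le_max x0 orbT.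
Qed.

Lemma budget_ge0 (i : agent S) t l : 0 <= budget D c i t l.
Proof.
apply: addr_ge0; first apply: mulr_ge0 => //.
  by elim/big_rec: _ => // j x _ x0; rewrite le_max x0 orbT.
rewrite /d_budget; case: ifP => lM; last exact: d_ter_ge0.
by case: t => [|t]; [exact: d_init_ge0 | rewrite mulr_ge0 ?nbr_dist_ge0].
Qed.

Lemma chi_ge0 (i : agent S) t l : 0 <= chi c i t l.
Proof. by elim: l => //= l IHl; rewrite addr_ge0 ?mulr_ge0 ?nbr_dist_ge0. Qed.

Lemma rtilde_ge0 (i : agent S) t l : 0 <= rtilde D c i t l.
Proof. by elim: l => //= l IHl; rewrite addr_ge0 ?mulr_ge0 ?budget_ge0. Qed.

Lemma xnomstar1 (i : agent S) t : xnomstar c i t 1 = traj c t.+1 i.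
Proof.
rewrite (cl_dyn Hcl) /g_all /xnomstar /xnom /=; congr net_g.
by apply: functional_extensionality_dep => j; rewrite /nbrs (cl_xbar0 Hcl).
Qed.

Section Transition.
Variable t : nat.
Hypothesis feas : forall i : agent S, ocp_feasible D c i t.
Hypothesis packet_X : forall (i : agent S) l, (l < hor D)%N ->
  in_XN (nbrs i (xbar c t l)).
Hypothesis tight : forall i : agent S, tightening_cond D c i t.

Let star i := (cl_opt Hcl (feas i)).1.

Lemma xnomstar_in_X (i : agent S) l :
  (0 < l <= hor D)%N -> net_X i (xnomstar c i t l).
Proof.
case/andP=> l0; rewrite leq_eqVlt => /orP[/eqP ->|lM]; last first.
  have lM' : (0 < l < hor D)%N by rewrite l0.
  exact: pdiff_ball2_sub (ocp_r (star i) lM') (ocp_x (star i) lM').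
(* (A) starts at index 1, so using it at [(hor D).-1] relies on M >= 2; [delta] is nonnegative, so
   its ball contains 0. *)
have MM : (0 < (hor D).-1 < hor D)%N by rewrite -ltnS !prednK // M_gt1 leqnn.
have := @tight i _ MM; rewrite prednK //.
by apply: pdiff_ball2_sub; rewrite addr_ge0 ?chi_ge0 ?rtilde_ge0.
Qed.

Lemma traj_next_in_X : in_X (traj c t.+1).
Proof. by move=> i; rewrite -xnomstar1; apply: xnomstar_in_X; rewrite M_gt0. Qed.

Lemma xbar_next_in_X (i : agent S) l :
  (l < hor D)%N -> net_X i (xbar c t.+1 l i).
Proof.
case: l => [|l] lM; first by rewrite (cl_xbar0 Hcl); exact: traj_next_in_X.
by rewrite (cl_xbar Hcl) //; exact: xnomstar_in_X.
Qed.

(** Both trajectories use the same inputs; they differ only through the neighbor packets, whose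
    mismatch [chi] accumulates. *)
Lemma xtilde_near (i : agent S) l : (l < hor D)%N ->
  norm2 (xtilde c i t l - xnomstar c i t l.+1) <= chi c i t l.
Proof.
elim: l => [_|l IHl lM].
  by rewrite xnomstar1 /xtilde /xnom /= subrr norm2_0.
have {}IHl := IHl (ltnW lM).
have xt_X : net_X i (xtilde c i t l).
  case: l IHl lM => [|l] IHl lM; first exact: traj_next_in_X.
  apply: pdiff_ball2_sub (rtilde_ge0 i t l.+1) _.
  by apply: pdiff_ball2_near IHl; apply: tight; exact: ltnW.
have us_U : net_U i (ustar c t l.+1 i) by exact: (ocp_u (star i)).
(* The packets compared are entry [l] sent at [t.+1] and entry [l.+1] sent at [t]; the common input
   cancels the [net_L3] term. *)
have := g_lipschitz HS xt_X (fun j => xbar_next_in_X (val j) (ltnW lM)) us_U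
  (@xnomstar_in_X i l.+1 (ltnW lM)) (packet_X lM) us_U.
rewrite (subrr (ustar c t l.+1 i)) norm2_0 mulr0 addr0 => /le_trans; apply.
by rewrite lerD2r ler_wpM2l.
Qed.

Lemma ocp_feasible_next (i : agent S) :
  terminal_cond D c i t -> ocp_feasible D c i t.+1.
Proof.
case=> v vU vter.
pose u l := if (l.+1 < hor D)%N then ustar c t l.+1 i else v.
(* The final input [v] acts only after index M-1, so up to there the rollout is the shifted one. *)
have uE l : (l < hor D)%N -> xnom c t.+1 u l = xtilde c i t l.
  move=> lM; apply: eq_rollout => k kl.
  by rewrite /u (leq_ltn_trans kl lM).
(* The radii [rtilde] satisfy the tube inequality with equality by definition. *)
exists u, (rtilde D c i t); split => //.
- by move=> l lM; rewrite /u; case: ifP => // /(ocp_u (star i)).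
- by move=> l _; exact: rtilde_ge0.
- move=> l /andP[l0 lM]; rewrite uE //.
  by apply: pdiff_ball2_near (xtilde_near i lM); apply: tight; rewrite l0.
- have -> : xnom c t.+1 u (hor D) =
      net_g (xtilde c i t (hor D).-1) (nbrs i (xbar c t.+1 (hor D).-1)) v.
    rewrite -uE ?ltn_predL // -[in LHS](prednK M_gt0) /xnom /=.
    by rewrite {2}/u prednK // ltnn.
  exact: vter.
Qed.

End Transition.
End RecursiveFeasibility.

Theorem corollary1 (R : realType) (S : network R) (D : design S) (c : run S)
    (HS : network_spec S) (HD : design_spec D) (Hcl : closed_loop D c)
    (Hfeas : forall i : agent S, ocp_feasible D c i 0)
    (HA : forall (t : nat) (i : agent S), tightening_cond D c i t)
    (HB : forall (t : nat) (i : agent S), terminal_cond D c i t)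
    (Hx0 : in_X (traj c 0)) :
  forall t : nat, in_X (traj c t) /\ in_U (uapp c t).
Proof.
have M_gt0 : (0 < hor D)%N := ltnW (hor_ge2 HD).
(* Packet admissibility joins the invariant because the next transition applies the Lipschitz bound
   at the packets of time [t]. *)
suff inv t : [/\ forall i, ocp_feasible D c i t, in_X (traj c t) &
    forall (i : agent S) l, (l < hor D)%N -> in_XN (nbrs i (xbar c t l))].
  move=> t; have [feas xX _] := inv t; split=> // i.
  exact: ocp_u (cl_opt Hcl (feas i)).1 _ M_gt0.
elim: t => [|t [feas _ pX]]; split=> //.
- move=> i [|l] lM j; first by rewrite /nbrs (cl_xbar0 Hcl).
  exact: (cl_init_x Hcl).
- by move=> i; apply: (ocp_feasible_next HS HD Hcl feas pX (HA t)).
- exact: (traj_next_in_X HS HD Hcl feas (HA t)).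
- by move=> i l lM j; exact: (xbar_next_in_X HS HD Hcl feas (HA t)).
Qed.
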